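(* There is an absolute constant $C>0$ such that for $\varepsilon\in(0,1)$, $\eta\in(0,1/2)$ and $b\ge C\frac{\log n}{\eta^3\varepsilon}$, there is an $\varepsilon$-LEDP algorithm in the billboard model that, on any $n$-vertex input graph $G$, with high probability outputs an implicit $b$-matching whose size is at least $\frac{1}{2+\eta}\mathrm{OPT}_b(G)$, where $\mathrm{OPT}_b(G)$ is the size of a maximum $b$-matching of $G$.
   Context: A $b$-matching is a set of edges in which every vertex has degree at most $b$. LEDP: each node knows only its adjacency list; in rounds, nodes apply local randomizers (edge-DP functions of their adjacency list, possibly depending on the public transcript) whose outputs are appended to a public transcript; the protocol is $\varepsilon$-LEDP if the map from the graph to the full transcript is $\varepsilon$-edge DP (edge-neighboring graphs differ in one edge). Billboard model: the transcript is public and each node $v$ deterministically decodes its part of the solution from it and $N(v)$. An implicit solution $\mathcal S=\{S_v\}_{v\in V}$ defines $H(\mathcal S)$ with edges $\{u,v\}$ such that $u\in S_v$ or $v\in S_u$; an implicit $b$-matching is one where $G\cap H(\mathcal S)$ has maximum degree at most $b$, and its size is $|E(G)\cap E(H(\mathcal S))|$. ''With high probability'' means probability at least $1-n^{-c}$ for a constant $c\ge1$. *)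

(* Defs.v *)
From HB Require Import structures.
From mathcomp Require Import all_boot all_order all_algebra.
From mathcomp Require Import all_classical all_reals all_analysis.
Set Implicit Arguments.
Unset Strict Implicit.
Unset Printing Implicit Defensive.
Import Order.TTheory GRing.Theory Num.Theory.
Local Open Scope classical_set_scope.
Local Open Scope ring_scope.

Record graph (n : nat) := Graph {
  adj : rel 'I_n;
  adj_sym : symmetric adj;
  adj_irr : irreflexive adj
}.

Definition neighbors n (G : graph n) (v : 'I_n) : {set 'I_n} :=
  [set u | adj G v u]%SET.

Definition edges n (G : graph n) : {set {set 'I_n}} :=
  [set [set p.1; p.2]%SET | p : 'I_n * 'I_n & adj G p.1 p.2]%SET.

Definition differ_by_one (T : finType) (A B : {set T}) : Prop :=
  #|((A :\: B) :|: (B :\: A))%SET| = 1%N.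

Definition edge_neighboring n (G G' : graph n) : Prop :=
  differ_by_one (edges G) (edges G').

Definition degree_in n (M : {set {set 'I_n}}) (v : 'I_n) : nat :=
  #|[set e in M | v \in e]%SET|.

Definition b_matching n (G : graph n) (b : nat) (M : {set {set 'I_n}}) : bool :=
  (M \subset edges G) && [forall v, (degree_in M v <= b)%N].

Definition OPT n (b : nat) (G : graph n) : nat :=
  \max_(M : {set {set 'I_n}} | b_matching G b M) #|M|.

Definition implicit_solution (n : nat) := 'I_n -> {set 'I_n}.

Section ImplicitGraph.
Variables (n : nat) (S : implicit_solution n).

(* S_v may contain v itself: this creates no loop. *)
Definition implicit_adj : rel 'I_n :=
  fun u v => (u != v) && ((u \in S v) || (v \in S u)).

Lemma implicit_adj_sym : symmetric implicit_adj.
Proof. by move=> u v; rewrite /implicit_adj eq_sym orbC. Qed.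

Lemma implicit_adj_irr : irreflexive implicit_adj.
Proof. by move=> u; rewrite /implicit_adj eqxx. Qed.

Definition implicit_graph : graph n := Graph implicit_adj_sym implicit_adj_irr.

End ImplicitGraph.

Definition kept_edges n (G : graph n) (S : implicit_solution n) :=
  (edges G :&: edges (implicit_graph S))%SET.

Definition implicit_b_matching n (G : graph n) (b : nat)
    (S : implicit_solution n) : Prop :=
  forall v, (degree_in (kept_edges G S) v <= b)%N.

Definition implicit_size n (G : graph n) (S : implicit_solution n) : nat :=
  #|kept_edges G S|.

(* Discrete distributions are given by their mass functions [p : T -> R]. *)
Definition mass (R : realType) (T : choiceType) (p : T -> R) (A : set T)
    : \bar R :=
  \esum_(x in A) (p x)%:E.

Definition is_pmf (R : realType) (T : choiceType) (p : T -> R) : Prop :=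
  (forall x, 0 <= p x) /\ mass p setT = 1%E.

Definition diff_private (R : realType) (X : Type) (T : choiceType)
    (neighboring : X -> X -> Prop) (eps : R) (p : X -> T -> R) : Prop :=
  forall x x' : X, neighboring x x' ->
  forall A : set T, (mass (p x) A <= (expR eps)%:E * mass (p x') A)%E.

Definition adjacency_list n (v : 'I_n) := {X : {set 'I_n} | v \notin X}.

Lemma neighbors_irr n (G : graph n) (v : 'I_n) : v \notin neighbors G v.
Proof. by rewrite inE adj_irr. Qed.

Definition adjlist n (G : graph n) (v : 'I_n) : adjacency_list v :=
  exist _ (neighbors G v) (neighbors_irr G v).

Definition adjlist_neighboring n (v : 'I_n) (X X' : adjacency_list v) : Prop :=
  differ_by_one (val X) (val X').

(* An edge-private randomized function of the adjacency list of v; its own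
   privacy parameter is unrelated to that of the whole protocol. *)
Definition local_randomizer (R : realType) n (v : 'I_n) (Y : choiceType)
    (r : adjacency_list v -> Y -> R) : Prop :=
  (forall X, is_pmf (r X)) /\
  exists2 e : R, 0 <= e & diff_private (@adjlist_neighboring n v) e r.

(* In a round all nodes speak simultaneously, with fresh independent
   randomness; a public transcript is the sequence of the message vectors of
   the successive rounds.  A node that is not active in a round, or a protocol
   that has halted, sends a constant message. *)
Record protocol (R : realType) (n : nat) := Protocol {
  rounds : nat;
  message : countType;
  randomizer : seq {ffun 'I_n -> message} ->
               forall v : 'I_n, adjacency_list v -> message -> R;
  randomizerP : forall h v, local_randomizer (@randomizer h v)
}.

Definition transcript (R : realType) n (P : protocol R n) :=
  (rounds P).-tuple {ffun 'I_n -> message P}.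

(* The chain rule: the messages of round t are independent conditionally on
   the transcript [take t tau] of the earlier rounds. *)
Definition transcript_pmf (R : realType) n (P : protocol R n) (G : graph n)
    (tau : transcript P) : R :=
  \prod_(t < rounds P) \prod_(v < n)
     randomizer (take t tau) (adjlist G v) (tnth tau t v).

Definition LEDP (R : realType) n (eps : R) (P : protocol R n) : Prop :=
  diff_private (@edge_neighboring n) eps (@transcript_pmf R n P).

(* The implicit solution is read off the public transcript. *)
Record billboard_algorithm (R : realType) (n : nat) := BillboardAlgorithm {
  proto :> protocol R n;
  solution : transcript proto -> implicit_solution n
}.

(* What node v, knowing only the transcript and N(v) = N, decodes: the other
   endpoints of its edges of G in the solution. *)
Definition decode (R : realType) n (A : billboard_algorithm R n)
    (tau : transcript A) (v : 'I_n) (N : {set 'I_n}) : {set 'I_n} :=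
  [set u in N | (u \in solution tau v) || (v \in solution tau u)]%SET.

Lemma mem_edges n (G : graph n) (u v : 'I_n) :
  ([set u; v]%SET \in edges G) = adj G u v.
Proof.
apply/imsetP/idP => [[[x y]]|uv]; last by exists (u, v); rewrite ?inE.
rewrite inE /= => xy /setP uvxy.
have xNy : x != y by apply: contraTneq xy => ->; rewrite adj_irr.
have /orP[/eqP xu|/eqP xv] : (x == u) || (x == v).
- by have := uvxy x; rewrite !inE eqxx.
- have /orP[/eqP yu|/eqP yv] : (y == u) || (y == v).
  + by have := uvxy y; rewrite !inE eqxx orbT.
  + by rewrite xu yu eqxx in xNy.
  + by rewrite -xu -yv.
have /orP[/eqP yu|/eqP yv] : (y == u) || (y == v).
- by have := uvxy y; rewrite !inE eqxx orbT.
- by rewrite -xv -yu adj_sym.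
- by rewrite xv yv eqxx in xNy.
Qed.

Lemma decodeE (R : realType) n (A : billboard_algorithm R n)
    (tau : transcript A) (G : graph n) (u v : 'I_n) :
  (u \in decode tau v (neighbors G v)) =
  ([set u; v]%SET \in kept_edges G (solution tau)).
Proof.
rewrite !inE !mem_edges /= /implicit_adj adj_sym.
by case: eqVneq => [->|//]; rewrite adj_irr.
Qed.

(* Main.v *)
(** All ordered pairs of nodes are scanned, one per round, and a pair is kept
    in the implicit graph unless one of its endpoints has announced that it is
    saturated.  A node with [c] kept incident edges of [G] has weight
    [w = expR (e * (c - K))], and announces saturation with probability
    [w / (1 + W)], where [W] sums its weights up to and including the present
    round.  The products of these conditional probabilities telescope: the node
    is still silent with probability [1 / (1 + W)], and it announces at a given
    round with probability [w / ((1 + W') (1 + W))], [W'] being the previous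
    value of [W].  One edge changes [w], [W] and [W'] by factors at most
    [expR e] at each of its two endpoints, so the protocol is [6 e]-LEDP for
    any number of rounds.  Conversely [1 + W], set to [0] at the announcement,
    is a martingale, so with high probability no node stays silent with
    [e * (c - K) >= a] nor announces with [e * (c - K) <= - a], for
    [a = 5 ln n].  The kept edges of [G] then form a [b]-matching in which every
    discarded edge has an endpoint of degree at least [b / (1 + eta / 2)]. *)

Require Import Defs.
From HB Require Import structures.
From mathcomp Require Import all_boot all_order all_algebra.
From mathcomp Require Import all_classical all_reals all_analysis.
From mathcomp Require Import ring lra.
Import Order.TTheory GRing.Theory Num.Theory.
Local Open Scope classical_set_scope.
Local Open Scope ring_scope.

Set Implicit Arguments.
Unset Strict Implicit.
Unset Printing Implicit Defensive.

(** * Masses and sums over finite sets *)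

Lemma mass_finite (R : realType) (T : finType) (p : T -> R) (A : set T) :
  (forall x, 0 <= p x) -> mass p A = (\sum_(x | x \in A) p x)%:E.
Proof.
move=> p_ge0; rewrite /mass esum_fset; last 2 first.
- exact: finite_finset.
- by move=> x _; rewrite lee_fin.
have AE : A = [set` [seq x <- enum T | x \in A]].
  apply/seteqP; split=> x /=; rewrite mem_filter mem_enum andbT ?inE //.
rewrite [in LHS]AE -fsbig_seq; last by rewrite filter_uniq // enum_uniq.
by rewrite sumEFin big_filter big_enum_cond.
Qed.

Lemma mass_le_scaled (R : realType) (T : finType) (p q : T -> R) (c : R)
    (A : set T) :
  (forall x, 0 <= p x) -> (forall x, 0 <= q x) ->
  (forall x, p x <= c * q x) -> (mass p A <= c%:E * mass q A)%E.
Proof.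
move=> p_ge0 q_ge0 le_pq; rewrite !mass_finite // -EFinM lee_fin mulr_sumr.
exact: ler_sum.
Qed.

Lemma sum_tuple_cons (R : nmodType) (M : finType) (k : nat)
    (F : seq M -> R) :
  \sum_(tau : k.+1.-tuple M) F tau =
  \sum_(m : M) \sum_(tau : k.-tuple M) F (m :: tau).
Proof.
rewrite pair_big /=.
rewrite (reindex (fun p : M * k.-tuple M => [tuple of p.1 :: p.2])) //=.
exists (fun tau => (thead tau, [tuple of behead tau])) => [[m tau] _|tau _] /=.
- by rewrite theadE; congr pair; apply: val_inj.
- by rewrite [RHS]tuple_eta; apply: val_inj.
Qed.

(** * Expectations along a sequence of random messages *)

Section SequentialExpectation.
Variables (R : realType) (M : finType) (p : seq M -> M -> R).
Hypothesis p_ge0 : forall h m, 0 <= p h m.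
Hypothesis p_sum : forall h, \sum_m p h m = 1.

Fixpoint chain (h s : seq M) : R :=
  if s is m :: s' then p h m * chain (rcons h m) s' else 1.

Lemma chain_ge0 h s : 0 <= chain h s.
Proof. by elim: s h => //= m s IH h; rewrite mulr_ge0. Qed.

Lemma chain_rcons h s m :
  chain h (rcons s m) = chain h s * p (h ++ s) m.
Proof.
elim: s h => [|m' s IH] h /=; first by rewrite cats0 mulr1 mul1r.
by rewrite IH cat_rcons mulrA.
Qed.

Lemma prod_tnth_chain k (h : seq M) (tau : k.-tuple M) :
  \prod_(t < k) p (h ++ take t tau) (tnth tau t) = chain h tau.
Proof.
elim: k h tau => [|k IH] h tau; first by rewrite big_ord0 tuple0.
case/tupleP: tau => m tau; rewrite big_ord_recl /= cats0 -IH.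
congr (_ * _); apply: eq_bigr => i _.
by rewrite cat_rcons tnthS.
Qed.

(** Peeling off the first message and inducting at the history extended by it leaves a single use of
    the one-step bound; the constants pass through because each conditional law sums to 1. *)
Lemma expectation_drift (f : seq M -> R) (d : R) k h :
  (forall h, \sum_m p h m * f (rcons h m) <= f h + d) ->
  \sum_(tau : k.-tuple M) chain h tau * f (h ++ tau) <= f h + k%:R * d.
Proof.
move=> drift; elim: k h => [|k IH] h.
  rewrite (bigD1 [tuple]) //= big1 => [|t]; last by case/eqP; exact: tuple0.
  by rewrite /= mul1r cats0 mul0r.
rewrite (@sum_tuple_cons _ _ _ (fun s => chain h s * f (h ++ s))) /=.
apply: (@le_trans _ _ (\sum_m p h m * (f (rcons h m) + k%:R * d))).
  apply: ler_sum => m _.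
  under eq_bigr do rewrite -cat_rcons -mulrA.
  by rewrite -mulr_sumr ler_wpM2l.
under eq_bigr do rewrite mulrDr.
rewrite big_split /= -mulr_suml p_sum mul1r.
rewrite -natr1 mulrDl mul1r addrA [leRHS]addrAC lerD2r.
exact: drift.
Qed.

End SequentialExpectation.

Lemma sum_ffun_marginal (R : comNzRingType) (I J : finType) (q : I -> J -> R)
    (i0 : I) (phi : J -> R) :
  (forall i, \sum_j q i j = 1) ->
  \sum_(m : {ffun I -> J}) (\prod_i q i (m i)) * phi (m i0) =
  \sum_j q i0 j * phi j.
Proof.
move=> q_sum.
(* Absorbing [phi] into factor [i0] restores a pure product, so that sum and product can be
   exchanged; every other factor then sums to 1. *)
pose F i j := q i j * (if i == i0 then phi j else 1).
transitivity (\sum_(m : {ffun I -> J}) \prod_i F i (m i)).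
  apply: eq_bigr => m _; rewrite big_split /=; congr (_ * _).
  by rewrite -big_mkcond /= big_pred1_eq.
rewrite -(bigA_distr_bigA F) (bigD1 i0) //= [X in _ * X]big1 => [|i /negPf ii0].
  by rewrite mulr1; apply: eq_bigr => j _; rewrite /F eqxx.
by under eq_bigr do rewrite /F ii0 mulr1; exact: q_sum.
Qed.

(** * Degree counts and nearly maximal matchings *)

Lemma degree_in_edges n (G : graph n) (v : 'I_n) :
  degree_in (edges G) v = #|neighbors G v|.
Proof.
rewrite /degree_in -(@card_in_imset _ _ (fun u => [set v; u]%SET)).
  congr #|pred_of_set _|; apply/setP=> e; apply/idP/imsetP.
    rewrite inE => /andP[/imsetP[[x y]]]; rewrite inE /= => xy -> .
    rewrite !inE => /orP[] /eqP ->; first by exists y; rewrite ?inE.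
    by exists x; rewrite ?inE 1?adj_sym 1?finset.setUC.
  by case=> u; rewrite !inE => vu ->; rewrite mem_edges vu !inE eqxx.
move=> x y; rewrite !inE => vx vy /finset.setP/(_ x).
rewrite !inE eqxx orbT => /esym/orP[]/eqP // xv.
by rewrite xv adj_irr in vx.
Qed.

Lemma card_edge n (G : graph n) e : e \in edges G -> #|e| = 2%N.
Proof.
case/imsetP=> -[x y]; rewrite inE /= => xy ->; rewrite cards2.
by case: eqVneq xy => // ->; rewrite adj_irr.
Qed.

Lemma sum_degree_in n (G : graph n) (M : {set {set 'I_n}}) :
  M \subset edges G -> (\sum_v degree_in M v = 2 * #|M|)%N.
Proof.
move=> /fintype.subsetP MG.
rewrite (eq_bigr (fun v => \sum_(e in M) (v \in e))%N); last first.
  by move=> v _; rewrite /degree_in -sum1dep_card big_mkcondr.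
rewrite exchange_big /= (eq_bigr (fun=> 2%N)); last first.
  by move=> e /MG/card_edge <-; rewrite -sum1_card [RHS]big_mkcond.
by rewrite sum_nat_const mulnC.
Qed.

Lemma degree_in_setID n (B M : {set {set 'I_n}}) v :
  degree_in B v =
  (degree_in (B :&: M)%SET v + degree_in (B :\: M)%SET v)%N.
Proof.
rewrite /degree_in -(cardsID M); congr (_ + _)%N.
- by apply: eq_card => e; rewrite !inE andbAC.
- by apply: eq_card => e; rewrite !inE andbA.
Qed.

Lemma degree_in_subset n (B M : {set {set 'I_n}}) v :
  B \subset M -> (degree_in B v <= degree_in M v)%N.
Proof.
move=> /fintype.subsetP BM; apply/subset_leq_card/fintype.subsetP=> e.
by rewrite !inE => /andP[/BM -> ->].
Qed.

(* Every edge of an optimal [B] outside [M] is charged to a saturated endpoint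
   [v], which is charged at most [b - degree_in (B :&: M) v] times. *)
Lemma OPT_le_nearly_maximal (R : realFieldType) n (G : graph n) (b : nat)
    (M : {set {set 'I_n}}) (lambda : R) :
  1 <= lambda -> M \subset edges G ->
  (forall e, e \in edges G -> e \notin M ->
    exists2 v, v \in e & b%:R <= lambda * (degree_in M v)%:R) ->
  (OPT b G)%:R <= 2 * lambda * #|M|%:R.
Proof.
move=> lambda_ge1 MG saturated; rewrite /OPT.
have [B /andP[BG /forallP B_deg] ->] :
    {B : {set {set 'I_n}} | b_matching G b B &
      \max_(M | b_matching G b M) #|M| = #|B|}.
  apply: eq_bigmax_cond; apply/card_gt0P; exists finset.set0.
  rewrite unfold_in; apply/andP; split; first exact: finset.sub0set.
  apply/forallP=> v; rewrite /degree_in (_ : [set e in _ | _]%SET = finset.set0).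
    by rewrite cards0.
  by apply/setP=> e; rewrite !inE.
pose S v := b%:R <= lambda * (degree_in M v)%:R.
have diff_le : (#|B :\: M|%SET <= \sum_(v | S v) degree_in (B :\: M)%SET v)%N.
  under eq_bigr do rewrite /degree_in -sum1dep_card big_mkcondr.
  rewrite exchange_big -sum1_card; apply: leq_sum => e.
  rewrite inE => /andP[eM /(fintype.subsetP BG) eG].
  have [v ve Sv] := saturated e eG eM.
  by rewrite (bigD1 v) //= ve.
have deg_le v : S v -> (degree_in (B :\: M)%SET v)%:R <=
    lambda * (degree_in M v)%:R - (degree_in (B :&: M)%SET v)%:R :> R.
  move=> Sv; rewrite lerBrDl -natrD -degree_in_setID.
  by apply: le_trans Sv; rewrite ler_nat.
(* Nonnegativity at every vertex, where [1 <= lambda] enters, extends the sum from saturated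
   vertices to all of them, and the handshake identity then applies. *)
have deg_ge0 v : 0 <=
    lambda * (degree_in M v)%:R - (degree_in (B :&: M)%SET v)%:R :> R.
  rewrite subr_ge0; apply: (@le_trans _ _ (degree_in M v)%:R).
    by rewrite ler_nat degree_in_subset // finset.subsetIr.
  by rewrite ler_peMl.
have : (#|B :\: M|%SET)%:R <= \sum_v
    (lambda * (degree_in M v)%:R - (degree_in (B :&: M)%SET v)%:R) :> R.
  apply: (@le_trans _ _ (\sum_(v | S v) (degree_in (B :\: M)%SET v))%:R).
    by rewrite ler_nat.
  rewrite natr_sum; apply: (le_trans (ler_sum _ deg_le)).
  rewrite [leRHS](bigID S) /= lerDl; apply: sumr_ge0 => v _; exact: deg_ge0.
rewrite sumrB -mulr_sumr -!natr_sum (sum_degree_in MG) (@sum_degree_in _ G).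
  rewrite -(cardsID M B) !natrM natrD => h.
  have := ler0n R #|B :&: M|%SET.
  set x := #|_ :&: _|%:R in h *; set y := #|_ :\: _|%:R in h *.
  by set z := #|M|%:R in h *; lra.
exact: fintype.subset_trans (finset.subsetIl _ _) BG.
Qed.

(** The kept edges are the edges of a graph whose adjacency is the conjunction of the two given
    ones; symmetry of [S] collapses the disjunction in [implicit_adj]. *)
Lemma degree_kept_edges n (G : graph n) (S : implicit_solution n) (v : 'I_n) :
  (forall u w, (u \in S w) = (w \in S u)) ->
  degree_in (kept_edges G S) v = #|neighbors G v :&: S v|%SET.
Proof.
move=> S_sym.
pose r := [rel x y | adj G x y && implicit_adj S x y].
have rs : symmetric r by move=> x y; rewrite /= adj_sym implicit_adj_sym.
have ri : irreflexive r by move=> x; rewrite /= adj_irr.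
have -> : kept_edges G S = edges (Graph rs ri).
  apply/setP=> e; rewrite inE; apply/andP/imsetP=> [[]|[[x y]]].
    move=> /imsetP[[x y]]; rewrite inE /= => xy ->; rewrite mem_edges => xy'.
    by exists (x, y); rewrite ?inE //=; apply/andP.
  by rewrite inE /= => /andP[xy xy'] ->; rewrite !mem_edges.
rewrite degree_in_edges; congr #|pred_of_set _|; apply/setP=> u.
rewrite !inE /= /implicit_adj -S_sym orbb.
by case: eqVneq => [->|]; rewrite ?adj_irr.
Qed.

(** * Neighborhoods in edge-neighboring graphs *)

Lemma differ_by_one_sym (T : finType) (A B : {set T}) :
  differ_by_one A B -> differ_by_one B A.
Proof. by rewrite /differ_by_one finset.setUC. Qed.

Lemma differ_by_one_card (T : finType) (A B : {set T}) :
  differ_by_one A B -> (#|A :\: B|%SET <= 1)%N.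
Proof. by move=> <-; apply: subset_leq_card; exact: finset.subsetUl. Qed.

(** Here [e0] is the differing edge: only its two endpoints see a different adjacency list, each by
    a single node. *)
Lemma edge_neighboring_neighbors n (G G' : graph n) :
  edge_neighboring G G' -> exists e0 : {set 'I_n}, #|e0| = 2%N /\
  forall v, (#|neighbors G v :\: neighbors G' v|%SET <= (v \in e0))%N /\
            (#|neighbors G' v :\: neighbors G v|%SET <= (v \in e0))%N.
Proof.
move=> /eqP/cards1P[e0 e0E]; exists e0; split.
  have : e0 \in [set e0]%SET by rewrite inE.
  by rewrite -e0E !inE => /orP[] /andP[_ /card_edge].
suff half (H H' : graph n) v : (edges H :\: edges H' \subset [set e0])%SET ->
    (#|neighbors H v :\: neighbors H' v|%SET <= (v \in e0))%N.
  by move=> v; split; apply: half; rewrite -e0E ?finset.subsetUl ?finset.subsetUr.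
move=> /fintype.subsetP sub.
have in_e0 x : x \in (neighbors H v :\: neighbors H' v)%SET -> e0 = [set v; x]%SET.
  rewrite !inE => /andP[x' x_]; have := sub [set v; x]%SET.
  by rewrite finset.in_setD !mem_edges x_ x' finset.in_set1 => /(_ isT)/eqP.
case: (boolP (v \in e0)) => ve0; last first.
  rewrite leqn0 cards_eq0; apply/eqP/setP=> x; rewrite finset.in_set0.
  by apply/negP=> /in_e0 e0x; rewrite e0x !inE eqxx in ve0.
apply/card_le1_eqP => x y xD yD.
have : x \in e0 by rewrite (in_e0 x xD) !inE eqxx orbT.
rewrite (in_e0 y yD) !inE => /orP[/eqP xv|/eqP //].
by move: xD; rewrite xv !inE !adj_irr andbF.
Qed.

Lemma one_le_expR (R : realType) (x : R) : 0 <= x -> 1 <= expR x.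
Proof. by move=> x0; rewrite -[1]expR0 ler_expR. Qed.

(** * Privacy of the announcements of one node *)

Section Mechanism.
Variables (R : realType) (n : nat) (e K a : R).
Hypothesis e_gt0 : 0 < e.
Let msg := {ffun 'I_n -> bool}.
Implicit Types (r : seq msg) (u v : 'I_n) (X : {set 'I_n}).

(** Accepting both orders of a pair makes the kept sets symmetric; distinct nodes are thus offered
    to each other twice. *)
Definition turn (t : nat) u v : bool :=
  (t == enum_rank (u, v)) || (t == enum_rank (v, u)).

Definition announced r v : bool := has (fun m : msg => m v) r.

(* Histories [r] are listed with the most recent round first. *)
Fixpoint kept r v : {set 'I_n} :=
  if r is m :: r' then
    (kept r' v :|:
     [set u | [&& turn (size r') u v, ~~ announced r u & ~~ announced r v]])%SET
  else finset.set0.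

Definition score r v X : R := e * (#|X :&: kept r v|%SET%:R - K).

Definition weight r v X : R := expR (score r v X).

(** This is [1 + W']: the weight of the round about to be played is still excluded. *)
Fixpoint total r v X : R :=
  if r is _ :: r' then total r' v X + weight r' v X else 1.

(* With this conditional probability of announcing, node [v] is still silent
   after [r] with probability [1 / total r v X]. *)
Definition hazard r v X : R := weight r v X / (total r v X + weight r v X).

(** After its announcement a node is silent with certainty, so its later messages reveal nothing. *)
Definition speak r v X (m : bool) : R :=
  if announced r v then (~~ m)%:R
  else if m then hazard r v X else 1 - hazard r v X.

Lemma weight_gt0 r v X : 0 < weight r v X.
Proof. exact: expR_gt0. Qed.

Lemma total_ge1 r v X : 1 <= total r v X.
Proof.
elim: r => //= m r IH; apply: le_trans IH _.
by rewrite lerDl ltW // weight_gt0.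
Qed.

Lemma total_gt0 r v X : 0 < total r v X.
Proof. exact: lt_le_trans (total_ge1 r v X). Qed.

Lemma silenceE r v X :
  1 - hazard r v X = total r v X / (total r v X + weight r v X).
Proof.
have := total_gt0 r v X; have := weight_gt0 r v X.
rewrite /hazard; move: (weight _ _ _) (total _ _ _) => w s w0 s0.
by field; lra.
Qed.

Lemma speak_ge0 r v X m : 0 <= speak r v X m.
Proof.
have h0 := total_gt0 r v X; have h1 := weight_gt0 r v X.
rewrite /speak; case: ifP => // _; case: m => /=; last rewrite silenceE.
- by rewrite divr_ge0 ?addr_ge0 // ltW.
- by rewrite divr_ge0 ?addr_ge0 // ltW.
Qed.

Lemma speak_sum r v X : \sum_m speak r v X m = 1.
Proof.
rewrite big_bool /= /speak; case: ifP => _ /=; first by rewrite add0r.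
by rewrite addrC subrK.
Qed.

(** The set [kept r v] is read off the public history, so both weights count within the same set and
    the two counts differ by at most one in this direction. *)
Lemma weight_le r v X X' :
  (#|X :\: X'|%SET <= 1)%N -> weight r v X <= expR e * weight r v X'.
Proof.
move=> le1; rewrite /weight -expRD ler_expR /score.
rewrite -{2}[e]mulr1 -mulrDr ler_pM2l // addrA lerD2r.
rewrite addrC natr1 ler_nat -addn1.
rewrite -(cardsID X' (X :&: kept r v)%SET); apply: leq_add.
  apply: subset_leq_card; apply/fintype.subsetP=> x; rewrite !inE.
  by case/andP=> /andP[_ ->] ->.
apply: leq_trans le1; apply: subset_leq_card; apply/fintype.subsetP=> x.
by rewrite !inE => /and3P[-> ->].
Qed.

Lemma total_le r v X X' :
  (#|X :\: X'|%SET <= 1)%N -> total r v X <= expR e * total r v X'.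
Proof.
move=> le1; elim: r => [|m r IH] /=; first by rewrite mulr1 one_le_expR ?ltW.
by rewrite mulrDr lerD // weight_le.
Qed.

Lemma inv_scaled_le (x y c : R) :
  0 < x -> 0 < y -> 0 < c -> y <= c * x -> x^-1 <= c * y^-1.
Proof.
move=> x0 y0 c0 yx; rewrite -[leLHS]mulr1 ler_pdivrMl //.
by rewrite mulrCA mulrA ler_pdivlMr // mul1r.
Qed.

Lemma speak_le r v X X' m :
  (#|X :\: X'|%SET <= 1)%N -> (#|X' :\: X|%SET <= 1)%N ->
  speak r v X m <= expR (e * 2) * speak r v X' m.
Proof.
move=> XX' X'X; have E1 : 1 <= expR (e * 2).
  by rewrite one_le_expR // mulr_ge0 // ltW.
rewrite /speak; case: ifP => _; first by rewrite ler_peMl.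
have -> : expR (e * 2) = expR e * expR e by rewrite mulr_natr mulr2n expRD.
have T := total_gt0 r v; have W := weight_gt0 r v.
have TW Y : 0 < total r v Y + weight r v Y by rewrite addr_gt0.
have den : (total r v X + weight r v X)^-1 <=
    expR e * (total r v X' + weight r v X')^-1.
  apply: inv_scaled_le; rewrite ?expR_gt0 //.
  by rewrite mulrDr lerD // ?weight_le ?total_le.
case: m; rewrite ?silenceE /hazard mulrACA ler_pM //.
- by rewrite ltW.
- by rewrite invr_ge0 ltW.
- exact: weight_le.
- by rewrite ltW.
- by rewrite invr_ge0 ltW.
- exact: total_le.
Qed.

Fixpoint run r v X : R :=
  if r is m :: r' then run r' v X * speak r' v X (m v) else 1.

Lemma run_ge0 r v X : 0 <= run r v X.
Proof. by elim: r => //= m r IH; rewrite mulr_ge0 // speak_ge0. Qed.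

Lemma run_silent r v X : ~~ announced r v -> run r v X = (total r v X)^-1.
Proof.
elim: r => [|m r IH] /=; first by rewrite invr1.
rewrite negb_or => /andP[/negbTE mv rv]; rewrite IH // /speak (negbTE rv) mv.
rewrite silenceE mulrA mulVf ?mul1r //.
by rewrite gt_eqF // total_gt0.
Qed.

(** A silent run costs one factor [expR e] by telescoping, the announcement costs two more, and the
    later messages are deterministic: the cost does not grow with the number of rounds. *)
Lemma run_le r v X X' :
  (#|X :\: X'|%SET <= 1)%N -> (#|X' :\: X|%SET <= 1)%N ->
  run r v X <= expR (e * 3) * run r v X'.
Proof.
move=> XX' X'X.
have expR3 : expR (e * 3) = expR e * expR (e * 2) by rewrite -expRD; congr expR; ring.
have E2 : 1 <= expR (e * 2) by rewrite one_le_expR // mulr_ge0 // ltW.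
have inv_le r0 : (total r0 v X)^-1 <= expR e * (total r0 v X')^-1.
  by apply: inv_scaled_le; rewrite ?expR_gt0 ?total_gt0 ?total_le.
elim: r => [|m r IH]; first by rewrite mulr1 one_le_expR // mulr_ge0 // ltW.
rewrite /=; have [rv|rv] := boolP (announced r v).
  by rewrite /speak rv mulrA ler_wpM2r.
rewrite !run_silent // expR3 mulrACA ler_pM ?speak_ge0 ?speak_le //.
by rewrite invr_ge0 ltW // total_gt0.
Qed.

(** * Bad events and their martingale *)

Fixpoint bad r v X : bool :=
  if r is m :: r' then
    bad r' v X || ~~ announced r' v &&
      (if m v then score r' v X <= - a else a <= score r' v X)
  else false.

(** The martingale is frozen at [expR a] from the first bad event on, so that Markov's inequality
    bounds the probability of such an event. *)
Definition potential r v X : R :=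
  if bad r v X then expR a else if announced r v then 0 else total r v X.

Lemma potential_ge0 r v X : 0 <= potential r v X.
Proof.
rewrite /potential; case: ifP => _; first exact: expR_ge0.
by case: ifP => // _; rewrite ltW // total_gt0.
Qed.

Lemma potential_local (m : msg) r v X :
  potential (m :: r) v X = potential ([ffun=> m v] :: r) v X.
Proof. by rewrite /potential /= !ffunE. Qed.

(** Silence contributes at most [total]: exactly that if it is not bad, and otherwise because
    [expR a <= weight]. An announcement contributes only if bad; then [weight * expR a <= 1], and
    [1 <= total] bounds the contribution by 1. *)
Lemma potential_drift r v X :
  \sum_(x : bool) speak r v X x * potential ([ffun=> x] :: r) v X <=
  potential r v X + 1.
Proof.
rewrite big_bool /= /potential /= !ffunE /= -!/(announced r v).
have T := total_gt0 r v X; have W := weight_gt0 r v X.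
case: (boolP (bad r v X)) => b /=.
  by rewrite -mulrDl; have := speak_sum r v X; rewrite big_bool /= => ->; rewrite mul1r lerDl.
case: (boolP (announced r v)) => rv /=; first by rewrite ?orbT !mulr0 !add0r.
rewrite /speak (negbTE rv) addrC lerD //.
  rewrite silenceE; case: ifP => sc.
    rewrite mulrAC ler_pdivrMr ?addr_gt0 // ler_pM2l //.
    have : expR a <= weight r v X by rewrite ler_expR.
    by move=> ?; lra.
  by rewrite mulfVK // gt_eqF // addr_gt0.
case: ifP => sc; last by rewrite mulr0.
rewrite /hazard mulrAC ler_pdivrMr ?addr_gt0 // mul1r.
have : weight r v X * expR a <= 1.
  by rewrite -expRD -expR0 ler_expR -lerBrDr sub0r.
have := total_ge1 r v X; lra.
Qed.

(** * Kept degrees when nothing bad happens *)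

Lemma kept_sym r u v : (u \in kept r v) = (v \in kept r u).
Proof.
elim: r => [|m r IH]; first by rewrite !inE.
by rewrite /= !inE IH /turn orbC [X in _ || X && _]orbC [X in _ || _ && X]andbC orbC.
Qed.

Lemma kept_cons_subset m r v : kept r v \subset kept (m :: r) v.
Proof. exact: finset.subsetUl. Qed.

(** The messages of a round are taken into account before its pair is kept, so an announcement
    already blocks the pair of its own round. *)
Lemma kept_announced m r v : announced (m :: r) v -> kept (m :: r) v = kept r v.
Proof.
move=> mr; apply/setP=> u; rewrite /= !inE.
by move: mr; rewrite /= => ->; rewrite !andbF orbF.
Qed.

Lemma turn_unique t u u' v : turn t u v -> turn t u' v -> u = u'.
Proof.
rewrite /turn => /orP[] /eqP -> /orP[] /eqP/val_inj/enum_rank_inj [] //.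
- by move=> -> ->.
- by move=> -> ->.
Qed.

Lemma card_kept_cons m r v X :
  (#|X :&: kept (m :: r) v|%SET <= #|X :&: kept r v|%SET + 1)%N.
Proof.
rewrite /= finset.setIUr; apply: leq_trans (leq_card_setU _ _) _.
rewrite leq_add2l; apply/card_le1_eqP => u u'; rewrite !inE.
by move=> /and4P[_ t _ _] /and4P[_ t' _ _]; exact: (turn_unique t' t).
Qed.

Lemma kept_complete r u v : (enum_rank (u, v) < size r)%N ->
  [|| u \in kept r v, announced r u | announced r v].
Proof.
elim: r => //= m r IH; rewrite ltnS leq_eqVlt => /orP[/eqP uv|/IH].
  rewrite !inE /turn -uv eqxx /=.
  by case: (m u || _); case: (m v || _); rewrite /= ?orbT.
by rewrite inE -!/(announced r _) => /or3P[] ->; rewrite ?orbT.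
Qed.

(** The count grows only in a round through which [v] stays silent. Before such a round the score is
    below [a], and the round adds at most one node, hence the [+ 1]. *)
Lemma not_bad_upper r v X (B : R) :
  K + a / e + 1 <= B -> 0 <= B -> ~~ bad r v X ->
  (#|X :&: kept r v|%SET)%:R <= B.
Proof.
move=> leB B0; elim: r => [|m r IH]; first by rewrite /= finset.setI0 cards0.
have := card_kept_cons m r v X; have := @kept_announced m r v.
move: (kept (m :: r) v) => kept' same le1.
rewrite /= negb_or => /andP[/IH leIH]; have [/same -> //|] := boolP (announced (m :: r) v). rewrite /= negb_or => /andP[/negbTE -> ->] /=; rewrite -ltNge => sc.
apply: (@le_trans _ _ (#|X :&: kept r v|%SET + 1)%:R).
  by rewrite ler_nat.
rewrite natrD; apply: le_trans leB; rewrite lerD2r.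
have : e * (#|X :&: kept r v|%SET%:R - K) < a by [].
by rewrite -ltr_pdivlMl // ltrBlDl [_^-1 * _]mulrC => /ltW.
Qed.

(** The bound holds at the round of the announcement and persists because kept sets only grow. *)
Lemma not_bad_lower r v X : ~~ bad r v X -> announced r v ->
  K - a / e <= (#|X :&: kept r v|%SET)%:R.
Proof.
elim: r => [|m r IH] //.
have : (#|X :&: kept r v|%SET)%:R <= (#|X :&: kept (m :: r) v|%SET)%:R :> R.
  by rewrite ler_nat subset_leq_card // finset.setIS // kept_cons_subset.
move: (kept (m :: r) v) => kept' mono.
rewrite /= negb_or -/(announced r v) => /andP[/IH leIH].
have [rv _ _|rv /= sc] := boolP (announced r v).
  exact: le_trans (leIH rv) mono.
rewrite orbF => mv; apply: le_trans mono.
move: sc; rewrite mv -ltNge /score => /ltW.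
by rewrite -ler_pdivrMl // lerBrDl mulrN [_^-1 * _]mulrC.
Qed.

End Mechanism.

(** * The protocol: privacy, failure probability, quality *)

Section Algorithm.
Variables (R : realType) (n : nat) (e K : R).
Hypothesis e_gt0 : 0 < e.

(** Transcripts list the earliest round first, hence the [rev]. *)
Definition saturation_randomizer (h : seq {ffun 'I_n -> bool}) (v : 'I_n)
    (X : adjacency_list v) (m : bool) : R := speak e K (rev h) v (val X) m.

Lemma saturation_randomizerP h v :
  @local_randomizer R n v bool (@saturation_randomizer h v).
Proof.
split=> [X|].
  split=> [m|]; first exact: speak_ge0.
  rewrite mass_finite => [|m]; last exact: speak_ge0.
  congr (_%:E); rewrite -[RHS](speak_sum e K (rev h) v (val X)).
  by apply: eq_bigl => m; rewrite in_setT.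
exists (e * 2) => [|X X' XX' A]; first by rewrite mulr_ge0 // ltW.
apply: mass_le_scaled => m; [exact: speak_ge0|exact: speak_ge0|].
apply: speak_le => //; first exact: differ_by_one_card.
exact/differ_by_one_card/differ_by_one_sym.
Qed.

Definition greedy_protocol : protocol R n :=
  @Protocol R n #|{: 'I_n * 'I_n}| bool saturation_randomizer
    saturation_randomizerP.

Definition greedy : billboard_algorithm R n :=
  @BillboardAlgorithm R n greedy_protocol (fun tau => kept (rev tau)).

Definition joint (G : graph n) (h : seq {ffun 'I_n -> bool})
    (m : {ffun 'I_n -> bool}) : R :=
  \prod_v speak e K (rev h) v (neighbors G v) (m v).

Lemma joint_ge0 G h m : 0 <= joint G h m.
Proof. by apply: prodr_ge0 => v _; exact: speak_ge0. Qed.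

Lemma joint_marginal G h v (phi : bool -> R) :
  \sum_m joint G h m * phi (m v) =
  \sum_x speak e K (rev h) v (neighbors G v) x * phi x.
Proof.
apply: (sum_ffun_marginal (q := fun u => speak e K (rev h) u (neighbors G u))).
by move=> u; exact: speak_sum.
Qed.

Lemma joint_sum G h : \sum_m joint G h m = 1.
Proof.
rewrite /joint -(bigA_distr_bigA
  (fun v x => speak e K (rev h) v (neighbors G v) x)) big1 // => v _.
exact: speak_sum.
Qed.

Lemma transcript_pmfE G (tau : transcript greedy_protocol) :
  transcript_pmf G tau = chain (joint G) [::] tau.
Proof. by rewrite -prod_tnth_chain. Qed.

(** Regrouping the factors by node instead of by round lets privacy be accounted node by node. *)
Lemma chain_run G s :
  chain (joint G) [::] s = \prod_v run e K (rev s) v (neighbors G v).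
Proof.
elim/last_ind: s => [|s m IH]; first by rewrite big1.
by rewrite chain_rcons IH rev_rcons /= big_split.
Qed.

Lemma greedy_LEDP : LEDP (e * 6) greedy.
Proof.
move=> G G' /edge_neighboring_neighbors[e0 [card_e0 GG']] A.
apply: mass_le_scaled => tau; rewrite ?transcript_pmfE ?chain_ge0 //.
- exact: joint_ge0.
- exact: joint_ge0.
rewrite !chain_run.
(* The budget is split evenly between the two endpoints of the differing edge; all other factors
   coincide. *)
have -> : expR (e * 6) = \prod_v (if v \in e0 then expR (e * 3) else 1).
  rewrite -big_mkcond /= prodr_const card_e0 -expRM_natr.
  by congr expR; ring.
rewrite -big_split; apply: ler_prod => v _; rewrite run_ge0 //=.
have [le1 le2] := GG' v; case: ifP => ve0; rewrite ve0 in le1 le2.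
  exact: run_le.
have -> : neighbors G v = neighbors G' v.
  by apply/eqP; rewrite finset.eqEsubset -!finset.setD_eq0 -!cards_eq0 -!leqn0 le1.
by rewrite mul1r.
Qed.

Lemma bad_unlikely (G : graph n) (a : R) :
  ((1 - n%:R * (1 + (n * n)%:R) * expR (- a))%:E <=
   mass (@transcript_pmf R n greedy G)
     [set tau : transcript greedy | forall v, ~~ bad e K a (rev tau) v (neighbors G v)])%E.
Proof.
set good := (X in mass _ X).
rewrite mass_finite => [|tau]; last first.
  by rewrite transcript_pmfE; apply: chain_ge0; exact: joint_ge0.
rewrite lee_fin.
(* Markov and union bound in one: [f] is at least -1 everywhere and nonnegative on transcripts with
   a bad node, so its expectation is at least minus the probability of [good]. *)
pose f h := expR (- a) * \sum_v potential e K a (rev h) v (neighbors G v) - 1.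
have f_ge h : -1 <= f h.
  rewrite /f lerDr mulr_ge0 ?expR_ge0 //; apply: sumr_ge0 => v _.
  exact: potential_ge0.
have drift h : \sum_m joint G h m * f (rcons h m) <= f h + n%:R * expR (- a).
  rewrite /f; under eq_bigr do rewrite mulrBr mulr1 mulrCA.
  rewrite sumrB joint_sum -mulr_sumr addrAC lerD2r [n%:R * _]mulrC -mulrDr.
  rewrite ler_pM2l ?expR_gt0 //.
  under eq_bigr do rewrite mulr_sumr.
  rewrite exchange_big /=.
  have -> : n%:R = \sum_(v < n) (1 : R) by rewrite sumr_const card_ord.
  rewrite -big_split; apply: ler_sum => v _ /=.
  under eq_bigr do rewrite rev_rcons potential_local.
  rewrite (joint_marginal G h v
    (fun x => potential e K a ([ffun=> x] :: rev h) v (neighbors G v))).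
  exact: potential_drift.
have := expectation_drift (joint_ge0 G) (joint_sum G)
  #|{: 'I_n * 'I_n}| [::] drift.
have f0 : f [::] = n%:R * expR (- a) - 1.
  rewrite /f (eq_bigr (fun=> 1)) ?sumr_const ?card_ord ?[_ * expR _]mulrC //.
rewrite f0 => le_f.
have : - \sum_(tau | tau \in good) transcript_pmf G tau <=
    \sum_(tau : #|{: 'I_n * 'I_n}|.-tuple {ffun 'I_n -> bool})
      chain (joint G) [::] tau * f tau.
  rewrite big_mkcond -sumrN; apply: ler_sum => tau _.
  have p_ge0 : 0 <= chain (joint G) [::] tau by exact/chain_ge0/joint_ge0.
  case: ifPn => [_|tauP].
    rewrite transcript_pmfE -[leLHS]mulr1 mulNr -mulrN ler_wpM2l //.
  rewrite oppr0 mulr_ge0 // subr_ge0.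
  have [v bv] : exists v, bad e K a (rev tau) v (neighbors G v).
    apply: contrapT => nobad; move/negP: tauP; apply; rewrite inE => v.
    by apply/negP => bv; apply: nobad; exists v.
  rewrite (bigD1 v) //= {1}/potential bv mulrDr -expRD addNr expR0 lerDl.
  rewrite mulr_ge0 ?expR_ge0 //; apply: sumr_ge0 => u _.
  exact: potential_ge0.
move: le_f; rewrite card_prod card_ord.
by move: (\sum_(tau | _) _) (\sum_tau _) => x y; lra.
Qed.

Lemma greedy_quality (G : graph n) (b : nat) (eta a : R)
    (tau : transcript greedy) :
  0 <= eta -> K + a / e + 1 <= b%:R -> b%:R <= (1 + eta / 2) * (K - a / e) ->
  (forall v, ~~ bad e K a (rev tau) v (neighbors G v)) ->
  implicit_b_matching G b (solution tau) /\
  1 / (2 + eta) * (OPT b G)%:R <= (implicit_size G (solution tau))%:R.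
Proof.
move=> eta_ge0 upper lower good.
have degE v : degree_in (kept_edges G (solution tau)) v =
    #|neighbors G v :&: kept (rev tau) v|%SET.
  by apply: degree_kept_edges => u w; exact: kept_sym.
split=> [v|].
  by rewrite degE -(ler_nat R); exact: not_bad_upper (good v).
rewrite mulrAC mul1r ler_pdivrMr; last lra.
(* The charging bound is used with [lambda = 1 + eta / 2]. *)
rewrite (_ : _ * _ = 2 * (1 + eta / 2) * (implicit_size G (solution tau))%:R); last first.
  by field.
apply: OPT_le_nearly_maximal; first lra.
  exact: finset.subsetIl.
move=> edge /imsetP[[x y]]; rewrite inE /= => xy {edge}->.
rewrite inE !mem_edges xy /= /implicit_adj (kept_sym _ y) orbb.
have -> /= : x != y by apply: contraTneq xy => ->; rewrite adj_irr.
move=> xNy; have : (enum_rank (x, y) < size (rev tau))%N.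
  by rewrite size_rev size_tuple ltn_ord.
move=> /kept_complete; rewrite (negbTE xNy) /=.
have saturated v : announced (rev tau) v ->
    b%:R <= (1 + eta / 2) * (degree_in (kept_edges G (solution tau)) v)%:R.
  move=> rv; apply: (le_trans lower); rewrite degE.
  by apply: ler_wpM2l; [lra|exact: (not_bad_lower e_gt0 (good v) rv)].
by case/orP=> /saturated; [exists x|exists y]; rewrite ?inE ?eqxx ?orbT.
Qed.

End Algorithm.

(** * Choice of the parameters *)

Lemma mass_subset (R : realType) (T : finType) (p : T -> R) (A B : set T) :
  (forall x, 0 <= p x) -> A `<=` B -> (mass p A <= mass p B)%E.
Proof.
move=> p_ge0 AB; rewrite !mass_finite // lee_fin [leLHS]big_mkcond [leRHS]big_mkcond.
apply: ler_sum => x _; case: ifPn => [|_]; last by case: ifP.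
by rewrite inE => /AB Bx; rewrite ifT // inE.
Qed.

(** From [1 - x <= expR (- x)] at [x = ln n], which gives [1 - 1 / n <= ln n]. It serves to absorb
    additive constants into multiples of [ln n]. *)
Lemma ln_nat_ge_half (R : realType) (n : nat) :
  (1 < n)%N -> 1 / 2 <= ln n%:R :> R.
Proof.
move=> n1; have n_pos : 0 < n%:R :> R by rewrite ltr0n ltnW.
have := expR_ge1Dx (- ln n%:R : R).
rewrite expRN lnK ?posrE // => h.
have : n%:R^-1 <= 2^-1 :> R by rewrite lef_pV2 ?posrE ?ler_nat.
lra.
Qed.

Unset Implicit Arguments.

Theorem mainTheorem7 (R : realType) :
  exists C c : R, 0 < C /\ 1 <= c /\
  forall (n b : nat) (eps eta : R),
    (0 < n)%N -> 0 < eps < 1 -> 0 < eta < 1 / 2 ->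
    C * (ln n%:R / (eta ^+ 3 * eps)) <= b%:R ->
  exists A : billboard_algorithm R n,
    LEDP eps A /\
    forall G : graph n,
      ((1 - n%:R `^ (- c))%R%:E <=
       mass (@transcript_pmf R n A G)
         [set tau : transcript A |
            (implicit_b_matching G b (solution tau) /\
             1 / (2 + eta) * (OPT b G)%:R <=
               (implicit_size G (solution tau))%:R)%R])%E.
Proof.
exists 100, 1; split; first lra; split=> // n b eps eta n0.
move=> /andP[eps_gt0 eps_lt1] /andP[eta_gt0 eta_lt] b_large.
have e_gt0 : 0 < eps / 6 by lra.
(* The factor 5 makes the failure bound [n * (1 + n ^ 2) / n ^ 5], at most [1 / n] for [n >= 2]; [K]
   is the largest threshold for which degrees stay within [b]. *)
pose a : R := 5 * ln n%:R; pose K : R := b%:R - 1 - a / (eps / 6).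
exists (greedy n K e_gt0); split.
  by have := @greedy_LEDP R n _ K e_gt0; rewrite divfK.
move=> G; case: (ltnP 1 n) => [n1|n1]; last first.
  (* For [n = 1] the required probability is 0. *)
  have -> : n%:R = 1 :> R by apply/eqP; rewrite pnatr_eq1 eqn_leq n1.
  rewrite powR1 subrr; apply: esum_ge0 => tau _; rewrite lee_fin.
  rewrite transcript_pmfE; apply: chain_ge0; exact: joint_ge0.
have n_ge2 : 2 <= n%:R :> R by rewrite ler_nat.
apply: (@le_trans _ _ (1 - n%:R * (1 + (n * n)%:R) * expR (- a))%:E).
  rewrite lee_fin lerD2l lerN2 powR_inv1 ?ler0n //.
  rewrite expRN /a expRM_natl lnK ?posrE ?ltr0n // natrM.
  have n_pos : 0 < n%:R :> R by lra.
  rewrite ler_pdivrMr ?exprn_gt0 // exprS mulKf ?gt_eqF //.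
  move: (n%:R : R) n_ge2 n_pos => x x2 x0.
  have x2_ge : 4 <= x ^+ 2 by nra.
  have -> : x ^+ 4 = x ^+ 2 * x ^+ 2 by ring.
  have : 0 <= (x - 2) * x ^+ 3 by rewrite mulr_ge0 ?exprn_ge0; lra.
  nra.
apply: (le_trans (bad_unlikely K e_gt0 G a)); apply: mass_subset => tau.
  rewrite transcript_pmfE; apply: chain_ge0; exact: joint_ge0.
apply: greedy_quality => //; [exact: ltW|by rewrite /K; lra|].
have ln_ge := ln_nat_ge_half R n1.
pose L : R := ln n%:R / eps.
have aE : a / (eps / 6) = 30 * L by rewrite /a /L; field; rewrite gt_eqF.
have L_ge : 1 <= 2 * L.
  by rewrite /L mulrA ler_pdivlMr //; lra.
have eta3 : 0 < eta ^+ 3 by rewrite exprn_gt0.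
have : 100 * L <= b%:R * eta ^+ 3.
  rewrite -ler_pdivrMr // /L; apply: le_trans b_large.
  by rewrite le_eqVlt; apply/orP; left; apply/eqP; field; rewrite !gt_eqF.
have b_ge0 := ler0n R b.
(* As [eta < 1 / 2], this gives [400 * L <= eta * b]. The goal amounts to [(1 + eta / 2) * (1 + 60 *
   L) <= eta * b / 2], whose left side is at most [78 * L] since [1 <= 2 * L]. *)
have : b%:R * eta ^+ 3 <= b%:R * (eta / 4).
  rewrite ler_wpM2l //; nra.
rewrite /K aE; nra.
Qed.
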